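(* Let $A\neq B$ be real $d\times d$ matrices such that the set $\mathscr{A}=\{A,B\}$ is $\tau$-permutable, where $\tau(X)=S^{-1}XS$ with $S$ a nonsingular matrix satisfying $\tau(A)=B$ and $\tau(B)=A$. Let $k\ge 1$ and let $$M=M_kM_{k-1}\cdots M_1,\qquad M_i\in\{A,B\}\ \text{ for } i=1,2,\ldots,k,$$ be any product of matrices from $\mathscr{A}$. Then the spectrum of the matrix $\tau(M)$ coincides with the spectrum of the matrix $M$. Moreover, if the number $k$ of factors is odd, then the products $M=M_k\cdots M_1$ and $\tau(M)=\tau(M_k)\cdots\tau(M_1)$ have different numbers of factors equal to $A$, and also different numbers of factors equal to $B$; consequently no cyclic permutation of the factors of $M$ coincides with any cyclic permutation of the factors of $\tau(M)$.
   Context: A set of two matrices $\mathscr{A}=\{A,B\}$, $A\ne B$, is called $\tau$-permutable if there is a nonsingular matrix $S$ such that the mapping $\tau(X):=S^{-1}XS$ satisfies $\tau(A)=B$ and $\tau(B)=A$. Numbers of factors and cyclic permutations of factors are understood at the level of the ordered tuples of factors (words in the letters $A,B$): the product $M$ corresponds to the tuple $(M_k,\ldots,M_1)$, and $\tau(M)$ is regarded as the product with tuple $(\tau(M_k),\ldots,\tau(M_1))$, whose entries again belong to $\{A,B\}$. A cyclic permutation of a tuple is a cyclic shift of its entries. *)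

(* Defs.v *)
From HB Require Import structures.
From mathcomp Require Import all_boot all_order all_algebra.
From mathcomp Require Import classical_sets reals.
From mathcomp Require Import complex.

Set Implicit Arguments.
Unset Strict Implicit.
Unset Printing Implicit Defensive.

Import GRing.Theory.
Local Open Scope ring_scope.

(* [invmx S] is the inverse of [S] only when [S \in unitmx]. *)
Definition tau (R : realType) (d : nat) (S X : 'M[R]_d) : 'M[R]_d :=
  invmx S *m X *m S.

Definition tau_permutable_by (R : realType) (d : nat) (S A B : 'M[R]_d) : Prop :=
  [/\ S \in unitmx, tau S A = B & tau S B = A].

(* A product M_k ... M_1 is encoded by its word [:: M_k; ...; M_1], so the
   factors are multiplied in the order in which they are listed. *)
Definition word_prod (R : realType) (d : nat) (w : seq 'M[R]_d) : 'M[R]_d :=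
  \big[mulmx/1%:M]_(X <- w) X.

Definition word_tau (R : realType) (d : nat) (S : 'M[R]_d)
    (w : seq 'M[R]_d) : seq 'M[R]_d :=
  [seq tau S X | X <- w].

(* The matrix is complexified first, so that non-real eigenvalues are included. *)
Definition spectrum (R : realType) (d : nat) (M : 'M[R]_d) : set R[i] :=
  [set z | eigenvalue (map_mx (real_complex R) M) z]%classic.

Definition cyclic_perm (T : Type) (u v : seq T) : Prop :=
  exists n : nat, v = rot n u.

(* Main.v *)
Require Import Defs.
From HB Require Import structures.
From mathcomp Require Import all_boot all_order all_algebra.
From mathcomp Require Import classical_sets reals.
From mathcomp Require Import complex.

Import GRing.Theory.
Local Open Scope ring_scope.

(** Conjugation by [S] is a ring automorphism, so it passes through products
    ([tau_word_prod]), and similar matrices have the same eigenvalues, over the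
    complex numbers as over any field ([eigenvalue_conj]).

    For the combinatorial part, conjugation exchanges the two letters, so the
    number of letters [B] in [tau(w)] is the number of letters [A] in [w]
    ([count_tau]), and vice versa.  In a word of length [k] these two numbers
    add up to [k] ([count_mem2]), so if [tau] preserved either of them then [k]
    would be even.  Since rotations preserve letter counts, no rotation of [w]
    is then a rotation of [tau(w)]. *)

(** If [v] is a left eigenvector of [g], then [v *m S] is one of the conjugate;
    the converse is the same fact for conjugation by [invmx S]. *)
Lemma eigenvalue_conj (F : fieldType) (n : nat) (S g : 'M[F]_n) (a : F) :
  S \in unitmx -> eigenvalue (invmx S *m g *m S) a = eigenvalue g a.
Proof.
have conj_eigen (T h : 'M[F]_n) : T \in unitmx ->
    eigenvalue h a -> eigenvalue (invmx T *m h *m T) a.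
  move=> unitT /eigenvalueP[v vh nz_v]; apply/eigenvalueP.
  exists (v *m T); first by rewrite !mulmxA mulmxK // vh scalemxAl.
  by apply: contraNneq nz_v => vT0; rewrite -(mulmxK unitT v) vT0 mul0mx.
move=> unitS; apply/idP/idP; last exact: conj_eigen.
have unitV : invmx S \in unitmx by rewrite unitmx_inv.
move=> /(conj_eigen _ _ unitV).
by rewrite invmxK !mulmxA mulmxV // mul1mx mulmxK.
Qed.

Lemma count_mem2 (T : eqType) (a b : T) (s : seq T) :
  a <> b -> (forall x, x \in s -> x = a \/ x = b) ->
  (count_mem a s + count_mem b s)%N = size s.
Proof.
move=> neq_ab s_ab; rewrite -(count_predC (pred1 a) s); congr addn.
apply: eq_in_count => x /s_ab[] -> /=.
  by rewrite eqxx; apply/eqP.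
by rewrite eqxx; apply/esym/eqP=> ba; apply: neq_ab.
Qed.

Section Conjugation.

Variables (R : realType) (d : nat) (S : 'M[R]_d).
Hypothesis unitS : S \in unitmx.

Lemma tau_inj : injective (tau S).
Proof.
by move=> X Y /(can_inj (mulmxK unitS)) /(can_inj (mulKVmx unitS)).
Qed.

Lemma tau_word_prod (w : seq 'M[R]_d) :
  tau S (word_prod w) = word_prod (word_tau S w).
Proof.
rewrite /word_prod /word_tau; elim: w => [|X w IHw] /=.
  by rewrite !big_nil /tau mulmx1 mulVmx.
by rewrite !big_cons -IHw /tau !mulmxA mulmxK.
Qed.

Lemma spectrum_tau (M : 'M[R]_d) : spectrum (tau S M) = spectrum M.
Proof.
rewrite /spectrum /tau; congr mkset; apply: boolp.funext => z.
by rewrite !map_mxM map_invmx eigenvalue_conj ?map_unitmx.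
Qed.

Lemma count_tau (X : 'M[R]_d) (w : seq 'M[R]_d) :
  count_mem (tau S X) (word_tau S w) = count_mem X w.
Proof.
by rewrite count_map; apply: eq_count => Y /=; rewrite (inj_eq tau_inj).
Qed.

End Conjugation.

Lemma cyclic_perm_count (T : Type) (p : pred T) (u v : seq T) :
  cyclic_perm u v -> count p v = count p u.
Proof. by case=> n ->; rewrite /rot count_cat addnC -count_cat cat_take_drop. Qed.

Theorem theorem2p5 (R : realType) (d : nat) (A B S : 'M[R]_d)
    (neqAB : A <> B) (permS : tau_permutable_by S A B)
    (k : nat) (k_gt0 : (0 < k)%N)
    (w : k.-tuple 'M[R]_d) (wAB : forall X, X \in w -> X = A \/ X = B) :
  [/\ tau S (word_prod w) = word_prod (word_tau S w),
      spectrum (tau S (word_prod w)) = spectrum (word_prod w) &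
      odd k ->
      [/\ count_mem A w <> count_mem A (word_tau S w),
          count_mem B w <> count_mem B (word_tau S w) &
          forall u v : seq 'M[R]_d,
            cyclic_perm w u -> cyclic_perm (word_tau S w) v -> u <> v]].
Proof.
case: permS => unitS tauA tauB.
split; [exact: tau_word_prod | exact: spectrum_tau |].
move=> odd_k.
have countA : count_mem A (word_tau S w) = count_mem B w.
  by rewrite -{1}tauB count_tau.
have countB : count_mem B (word_tau S w) = count_mem A w.
  by rewrite -{1}tauA count_tau.
have neq_count : count_mem A w <> count_mem B w.
  move=> eq_count; move: odd_k.
  by rewrite -(size_tuple w) -(count_mem2 _ A B) // eq_count addnn odd_double.
split.
- by rewrite countA.
- by rewrite countB => /esym.
move=> u v /(cyclic_perm_count _ (pred1 A)) uA.
move=> /(cyclic_perm_count _ (pred1 A)) vA uv.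
by apply: neq_count; rewrite -countA -uA -vA uv.
Qed.
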